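(* Let $S \subseteq \mathbb{Z}^2$. (a) If $S$ is B-stable and contains any three points of a border triangle, then $S = \mathbb{Z}^2$. (b) If $S$ is BI-stable and contains any three points of a minimal triangle, then $S = \mathbb{Z}^2$. (c) If $S$ is I-stable and contains any three points of an internal triangle, then $S$ is the image under some unimodular transformation of one of $J_{1/4}$, $J_{1/2}$, or $\mathbb{Z}^2$.
   Context: A lattice triangle is the convex hull in $\mathbb{R}^2$ of three non-collinear points of $\mathbb{Z}^2$. A triangle is a set $T = \Delta \cap \mathbb{Z}^2$ for a lattice triangle $\Delta$. A triangle is minimal if it contains exactly $4$ points of $\mathbb{Z}^2$; a minimal triangle is a border triangle if its non-vertex point lies on the boundary of $\Delta$, and an internal triangle if that point lies in the interior of $\Delta$. A set $S \subseteq \mathbb{Z}^2$ is B-stable if no border triangle has exactly three of its points in $S$; I-stable if no internal triangle has exactly three of its points in $S$; BI-stable if both. A unimodular transformation is a map $\mathbb{Z}^2 \to \mathbb{Z}^2$, $x \mapsto Mx + b$, with $M$ an integer $2\times 2$ matrix of determinant $\pm 1$ and $b \in \mathbb{Z}^2$. Let $\Delta_0 = \{(0,0),(1,0),(0,1),(-1,-1)\}$, $J_{1/4} = \Delta_0 + 4\mathbb{Z}^2$ and $J_{1/2} = J_{1/4} \cup (J_{1/4} + (2,2))$. *)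

(* Defs.v *)
From HB Require Import structures.
From mathcomp Require Import all_boot all_order all_algebra.
From mathcomp Require Import all_classical all_reals all_analysis.
Set Implicit Arguments.
Unset Strict Implicit.
Unset Printing Implicit Defensive.
Import Order.TTheory GRing.Theory Num.Theory.
Import numFieldNormedType.Exports.
Local Open Scope classical_set_scope.
Local Open Scope ring_scope.
Local Open Scope card_scope.

Notation Z2 := 'cV[int]_2.

Definition vec2 (x y : int) : Z2 := \col_(i < 2) (if i == 0 then x else y).

Section Triangles.
Variable R : realType.

Definition toR2 (p : Z2) : 'cV[R]_2 := map_mx intr p.

Definition convex_hull (A : set 'cV[R]_2) : set 'cV[R]_2 :=
  smallest (@convex_set R 'cV[R]_2) A.

Definition boundary (A : set 'cV[R]_2) : set 'cV[R]_2 :=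
  closure A `\` interior A.

Definition line (a v : 'cV[R]_2) : set 'cV[R]_2 :=
  [set a + t *: v | t in [set: R]].

Definition collinear (A : set 'cV[R]_2) : Prop :=
  exists a v, v != 0 /\ A `<=` line a v.

Definition lattice_triangle_with (a b c : Z2) (D : set 'cV[R]_2) : Prop :=
  ~ collinear (toR2 @` [set a; b; c]) /\
  D = convex_hull (toR2 @` [set a; b; c]).

Definition lattice_points (D : set 'cV[R]_2) : set Z2 := toR2 @^-1` D.

Definition triangle (T : set Z2) : Prop :=
  exists a b c D, lattice_triangle_with a b c D /\ T = lattice_points D.

Definition minimal_triangle (T : set Z2) : Prop :=
  triangle T /\ T #= `I_4.

Definition border_triangle (T : set Z2) : Prop :=
  minimal_triangle T /\
  exists a b c D p,
    [/\ lattice_triangle_with a b c D, T = lattice_points D,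
        (T `\` [set a; b; c]) p & boundary D (toR2 p)].

Definition internal_triangle (T : set Z2) : Prop :=
  minimal_triangle T /\
  exists a b c D p,
    [/\ lattice_triangle_with a b c D, T = lattice_points D,
        (T `\` [set a; b; c]) p & interior D (toR2 p)].

Definition B_stable (S : set Z2) : Prop :=
  ~ exists T, border_triangle T /\ T `&` S #= `I_3.

Definition I_stable (S : set Z2) : Prop :=
  ~ exists T, internal_triangle T /\ T `&` S #= `I_3.

Definition BI_stable (S : set Z2) : Prop := B_stable S /\ I_stable S.

End Triangles.

Definition contains_three_points (S T : set Z2) : Prop :=
  exists U : set Z2, [/\ U `<=` T, U #= `I_3 & U `<=` S].

Definition unimodular (f : Z2 -> Z2) : Prop :=
  exists (M : 'M[int]_2) (b : Z2),
    (\det M = 1 \/ \det M = -1) /\ forall x, f x = M *m x + b.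

Definition Delta0 : set Z2 :=
  [set vec2 0 0; vec2 1 0; vec2 0 1; vec2 (-1) (-1)].

Definition J_quarter : set Z2 :=
  [set x + q *+ 4 | x in Delta0 & q in [set: Z2]].

Definition J_half : set Z2 :=
  J_quarter `|` [set x + vec2 2 2 | x in J_quarter].

(* Main.v *)
(** The point set of a minimal triangle is, in suitable integral affine
coordinates of determinant one, either [{0, e1, -e1, e2}] (border) or
[{0, e1, e2, -e1-e2}] (internal).  Indeed, joining the fourth point to the
vertices cuts the triangle into empty lattice triangles, which have unit
doubled area, so the doubled areas of the three pieces are all [0] or [1].

(a) Three consecutive points on a line force the two adjacent parallel lattice
lines entirely into [S], hence all lines.  (b) A unimodular triangle in [S]
produces three consecutive points by B-stability.  (c) Write [e3 = -e1-e2] and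
[J] for the standard set [J_quarter].  A finite derivation shows that an
I-stable set containing [Delta0] contains its translates by [4 e1], [4 e2] and
[4 e3], hence [J].  The sets [J], [J + 2 e1], [J + 2 e2], [J + 2 e3] partition
the lattice; further finite derivations show that one point of [J + 2 ei] brings
in all of it, and that two of these three sets bring in the third.  The
rotation [e1 -> e2 -> e3 -> e1] reduces the case of exactly one to
[J_half]. *)

Require Import Defs.
From HB Require Import structures.
From mathcomp Require Import all_boot all_order all_algebra.
From mathcomp Require Import all_classical all_reals all_analysis.
From mathcomp Require Import zify ring lra.
Set Implicit Arguments.
Unset Strict Implicit.
Unset Printing Implicit Defensive.
Import Order.TTheory GRing.Theory Num.Theory.
Import numFieldNormedType.Exports.
Local Open Scope classical_set_scope.
Local Open Scope ring_scope.
Local Open Scope card_scope.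

(** * Cardinality of explicit finite sets *)

Lemma card_eq_seq (T : eqType) (s : seq T) : uniq s -> [set` s] #= `I_(size s).
Proof.
elim: s => [|x s IHs] /=; first by rewrite set_nil II0 card_eq00.
case/andP=> xs us; apply/eq_cardSP; exists x; first by rewrite /= mem_head.
rewrite (_ : _ `\ x = [set` s]) ?IHs//; apply/seteqP; split=> y /=.
  by rewrite inE => -[/orP[/eqP ->|//]].
by move=> ys; rewrite inE ys orbT; split=> // yx; rewrite -yx ys in xs.
Qed.

Lemma card_eqSD1 (T : Type) (A : set T) (x : T) n :
  A #= `I_n.+1 -> A x -> A `\ x #= `I_n.
Proof.
move=> cA Ax.
have /finite_setP[m cm] : finite_set (A `\ x).
  by apply: finite_setD; apply/finite_setP; exists n.+1.
have cA' : A #= `I_m.+1 by apply/eq_cardSP; exists x.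
have /card_eq_II[<-//] : `I_m.+1 #= `I_n.+1.
by rewrite -(card_eql cA').
Qed.

Lemma card_eq_seq_eq (T : eqType) (s : seq T) (A : set T) :
  A #= `I_(size s) -> uniq s -> [set` s] `<=` A -> A = [set` s].
Proof.
elim: s A => [|x s IHs] A /=.
  by rewrite II0 card_eq0 => /eqP -> _ _; rewrite set_nil.
move=> cA /andP[xs us] sA.
have Ax : A x by apply: sA => /=; rewrite mem_head.
have sAx : [set` s] `<=` A `\ x.
  move=> y /= ys; split; first by apply: sA; rewrite /= inE ys orbT.
  by move=> yx; rewrite -yx ys in xs.
have Ds := IHs _ (card_eqSD1 cA Ax) us sAx.
apply/seteqP; split=> // y Ay /=; rewrite inE; have [//|/eqP yx] := eqVneq y x.
by have : (A `\ x) y by []; rewrite Ds.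
Qed.

Lemma card_eq_notin (T : eqType) (A : set T) (s : seq T) n :
  A #= `I_n -> (size s < n)%N -> exists2 x, A x & x \notin s.
Proof.
elim: s A n => [|x s IHs] A [//|n] cA.
  by have /eq_cardSP[x] := cA; exists x.
rewrite ltnS => sn; have [Ax|nAx] := pselect (A x).
  have [y [Ay yx] ys] := IHs _ _ (card_eqSD1 cA Ax) sn.
  by exists y; rewrite // inE negb_or ys andbT; apply/eqP.
have [y Ay ys] := IHs _ _ cA (ltnW sn).
by exists y; rewrite // inE negb_or ys andbT; apply/eqP => yx; rewrite yx in Ay.
Qed.

(** A point of [A] outside [S] would squeeze the intersection of [A] and [S] between [U] and [A]
    minus that point, both of size three. *)
Lemma full_of_three (T : Type) (A S U : set T) :
  A #= `I_4 -> ~ (A `&` S #= `I_3) ->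
  U `<=` A -> U #= `I_3 -> U `<=` S -> A `<=` S.
Proof.
move=> cA nAS UA cU US x Ax; apply: contrapT => nSx; apply: nAS.
rewrite card_eq_le -!(card_le_eqr cU); apply/andP; split.
  rewrite (card_le_eqr cU) -(card_le_eqr (card_eqSD1 cA Ax)).
  apply: subset_card_le => y [Ay Sy]; split=> // yx; rewrite -yx // in nSx.
rewrite -(card_le_eql cU).
by apply: subset_card_le => y Uy; split; [exact: UA|exact: US].
Qed.

(** * Orientation and planar triangles *)

Definition det2 (K : comNzRingType) (u v : 'cV[K]_2) : K :=
  u 0 0 * v 1 0 - u 1 0 * v 0 0.

(** Twice the signed area of the triangle [a b c], positive for counterclockwise vertices. *)
Definition orient (K : comNzRingType) (a b c : 'cV[K]_2) : K :=
  det2 (b - a) (c - a).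

Lemma cV2_eq (K : Type) (u v : 'cV[K]_2) :
  u 0 0 = v 0 0 -> u 1 0 = v 1 0 -> u = v.
Proof.
move=> e0 e1; apply/matrixP => i j; rewrite (ord1 j).
by case: i => -[|[|//]] i2; [move: e0|move: e1]; congr (_ = _); congr (_ _ _);
  apply/val_inj.
Qed.

Section Orientation.
Variable K : comNzRingType.
Implicit Types a b c u v : 'cV[K]_2.

Lemma orientE a b c : orient a b c =
  (b 0 0 - a 0 0) * (c 1 0 - a 1 0) - (b 1 0 - a 1 0) * (c 0 0 - a 0 0).
Proof. by rewrite /orient /det2 !mxE. Qed.

Lemma orient_swap a b c : orient a c b = - orient a b c.
Proof. by rewrite !orientE; ring. Qed.

Lemma orient_rot a b c : orient b c a = orient a b c.
Proof. by rewrite !orientE; ring. Qed.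

Lemma orientaac a c : orient a a c = 0.
Proof. by rewrite !orientE; ring. Qed.

Lemma orientaba a b : orient a b a = 0.
Proof. by rewrite !orientE; ring. Qed.

Lemma orientabb a b : orient a b b = 0.
Proof. by rewrite !orientE; ring. Qed.

Lemma orient_split a b c p :
  orient p b c + orient a p c + orient a b p = orient a b c.
Proof. by rewrite !orientE; ring. Qed.

(** Barycentric coordinates scaled by [orient a b c]; without division the identity serves both the
    reals and the integers. *)
Lemma orient_bary a b c p :
  orient a b c *: p =
  orient p b c *: a + orient a p c *: b + orient a b p *: c.
Proof. by apply: cV2_eq; rewrite !mxE !orientE; ring. Qed.

End Orientation.

Section Hull.
Variable R : realType.
Implicit Types a b c y : 'cV[R]_2.

(** The three half-planes cut out a convex set containing the vertices, hence the hull. Conversely,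
    as convexity mixes two points at a time, [y] is written as a combination of [a] and a point of
    the segment [b c]. *)
Lemma convex_hull3P a b c y : 0 < orient a b c ->
  convex_hull [set a; b; c] y <->
  [/\ 0 <= orient y b c, 0 <= orient a y c & 0 <= orient a b y].
Proof.
move=> d0; split.
  pose I := [set y | [/\ 0 <= orient y b c, 0 <= orient a y c &
                         0 <= orient a b y]].
  move: y; apply: (@smallest_sub _ _ _ I).
    move=> x z t /set_mem[x1 x2 x3] /set_mem[z1 z2 z3]; apply/mem_set.
    have t0 : 0 <= t%:num by [].
    have t1 : 0 <= 1 - t%:num by rewrite subr_ge0.
    have comb (f : 'cV[R]_2 -> R) :
        f (conv t x z) = t%:num * f x + (1 - t%:num) * f z ->
        0 <= f x -> 0 <= f z -> 0 <= f (conv t x z).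
      by move=> -> fx fz; rewrite addr_ge0 ?mulr_ge0.
    by split; [apply: (comb (fun y => orient y b c))
              |apply: (comb (fun y => orient a y c))
              |apply: (comb (fun y => orient a b y))] => //;
       rewrite !orientE !mxE /unstable.onem; ring.
  by move=> x [[->|->]|->]; split;
    rewrite ?orientaac ?orientaba ?orientabb ?lexx ?ltW.
move=> [y1 y2 y3].
have cH : convex_set (convex_hull [set a; b; c] : set (convex_lmodType _)).
  move=> x z t /set_mem xH /set_mem zH; apply/mem_set => D [cD sD].
  by apply/set_mem/cD; apply/mem_set; [apply: xH|apply: zH].
have [aH bH cH'] : [/\ convex_hull [set a; b; c] a, convex_hull [set a; b; c] b
   & convex_hull [set a; b; c] c].
  by split; apply: sub_gen_smallest; [left; left|left; right|right].
have := orient_bary a b c y; have := orient_split a b c y.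
move: (orient y b c) (orient a y c) (orient a b y) y1 y2 y3 => al be ga.
move=> al0 be0 ga0 sumE yE.
(* If both weights vanish, the point on [b c] is undefined, but then [y] is [a]. *)
have [bg0|bg0] := eqVneq (be + ga) 0.
  have [b0 g0] : be = 0 /\ ga = 0 by lra.
  suff -> : y = a by [].
  apply: (scalerI (lt0r_neq0 d0)).
  by rewrite yE b0 g0 !scale0r !addr0 -sumE b0 g0 !addr0.
have bg : 0 < be + ga by lra.
have t01 : 0 <= be / (be + ga) by rewrite divr_ge0 // ltW.
have t11 : be / (be + ga) <= 1 by rewrite ler_pdivrMr // mul1r; lra.
have s01 : 0 <= al / orient a b c by rewrite divr_ge0 // ltW.
have s11 : al / orient a b c <= 1 by rewrite ler_pdivrMr // mul1r; lra.
have /set_mem w := cH _ _ (Itv01 t01 t11) (mem_set bH) (mem_set cH').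
have /set_mem := cH _ _ (Itv01 s01 s11) (mem_set aH) (mem_set w).
congr (convex_hull _ _); apply: (scalerI (lt0r_neq0 d0)).
have dN : orient a b c != 0 by rewrite lt0r_neq0.
rewrite yE; apply: cV2_eq; rewrite !mxE /= /unstable.onem -sumE; field;
  by rewrite sumE dN bg0.
Qed.

(** An affine function nonnegative on the triangle and positive at a vertex cannot vanish at an
    interior point: a small move away from that vertex would make it negative. Conversely, three
    open half-planes meet in an open set inside the hull. *)
Lemma interior_hull3P a b c y : 0 < orient a b c ->
  interior (convex_hull [set a; b; c]) y <->
  [/\ 0 < orient y b c, 0 < orient a y c & 0 < orient a b y].
Proof.
move=> d0; split=> [|[y1 y2 y3]].
  rewrite /interior /= => yI.
  have /nbhs_ballP[e /= e0 yH] : nbhs y (convex_hull [set a; b; c]) := yI.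
  have stretch v :
      exists2 t, 0 < t & convex_hull [set a; b; c] (y + t *: (y - v)).
    (* [m] exceeds both coordinates of [y - v] in absolute value, so the factor [e / m] keeps the
       displacement inside the ball. *)
    pose m := 1 + `|y 0 0 - v 0 0| + `|y 1 0 - v 1 0|.
    have m0 : 0 < m by rewrite /m; have := normr_ge0 (y 0 0 - v 0 0);
      have := normr_ge0 (y 1 0 - v 1 0); lra.
    have t0 : 0 < e / m by rewrite divr_gt0.
    exists (e / m) => //; apply: yH; split=> // i j.
    rewrite -ball_normE /= (ord1 j) !mxE opprD addNKr normrN normrM.
    rewrite gtr0_norm // mulrAC ltr_pdivrMr // ltr_pM2l // /m.
    have [-> | ->] : i = 0 \/ i = 1.
      by case: i => -[|[|//]] ?; [left|right]; apply/val_inj.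
    - by have := normr_ge0 (y 1 0 - v 1 0); lra.
    - by have := normr_ge0 (y 0 0 - v 0 0); lra.
  have strict (f : 'cV[R]_2 -> R) v :
      (forall t, f (y + t *: (y - v)) = f y + t * (f y - f v)) ->
      (forall z, convex_hull [set a; b; c] z -> 0 <= f z) -> 0 < f v -> 0 < f y.
    move=> fE f0 fv; have [t t0 /f0] := stretch v; rewrite fE => ft.
    have fy : 0 <= f y.
      by apply: f0; apply: yH; apply: ballxx.
    by nra.
  split; [apply: (strict (fun y => orient y b c) a)
         |apply: (strict (fun y => orient a y c) b)
         |apply: (strict (fun y => orient a b y) c)] => //;
    by [move=> z /(convex_hull3P _ d0)[]|move=> t; rewrite !orientE !mxE; ring].
have op (f : 'cV[R]_2 -> R) : continuous f -> 0 < f y ->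
    nbhs y [set z | 0 < f z].
  move=> cf fy; exact: cvgr_gt (cf y) _ fy.
have cont i : continuous (fun z : 'cV[R]_2 => z i 0) by exact: coord_continuous.
have co (s t u v : R) :
    continuous (fun z : 'cV[R]_2 => (z 0 0 - s) * t + (z 1 0 - u) * v).
  move=> z; exact: (cvgD (cvgM (cvgB (cont 0 z) (cvg_cst s)) (cvg_cst t))
                         (cvgM (cvgB (cont 1 z) (cvg_cst u)) (cvg_cst v))).
have aff (f : 'cV[R]_2 -> R) s t u v :
   (forall z, f z = (z 0 0 - s) * t + (z 1 0 - u) * v) -> continuous f.
  by move=> fE; rewrite (funext fE).
have c1 : continuous (fun z : 'cV[R]_2 => orient z b c).
  apply: (aff _ (b 0 0) (b 1 0 - c 1 0) (b 1 0) (c 0 0 - b 0 0)) => z.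
  by rewrite orientE; ring.
have c2 : continuous (fun z : 'cV[R]_2 => orient a z c).
  apply: (aff _ (a 0 0) (c 1 0 - a 1 0) (a 1 0) (a 0 0 - c 0 0)) => z.
  by rewrite orientE; ring.
have c3 : continuous (fun z : 'cV[R]_2 => orient a b z).
  apply: (aff _ (a 0 0) (a 1 0 - b 1 0) (a 1 0) (b 0 0 - a 0 0)) => z.
  by rewrite orientE; ring.
have sub : [set z | 0 < orient z b c] `&`
    ([set z | 0 < orient a z c] `&` [set z | 0 < orient a b z]) `<=`
    convex_hull [set a; b; c].
  by move=> z [/= z1 [/= z2 z3]]; apply/convex_hull3P => //; split; exact: ltW.
have Fy := nbhs_filter y.
have n := filterI (op _ c1 y1) (filterI (op _ c2 y2) (op _ c3 y3)).
exact: (@filterS _ (nbhs y) Fy _ _ sub (n Fy Fy)).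
Qed.

End Hull.

(** * Sets of integer pairs closed under internal triangles *)

Local Notation pt := (int * int)%type.

(** The condition on [u] and [v] makes [p] the inner point of an internal triangle with vertices
    [p + u], [p + v], [p - u - v]. Two rules suffice, since replacing [(u, v)] by [(v, - u - v)]
    permutes the vertices. *)
Definition internal_closed (Q : set pt) :=
  forall p u v : pt, `|u.1 * v.2 - u.2 * v.1| = 1 ->
    (Q p -> Q (p + u) -> Q (p + v) -> Q (p - u - v)) /\
    (Q (p + u) -> Q (p + v) -> Q (p - u - v) -> Q p).

(* The step [(p, u, v)] adds the missing one of [p], [p - u - v] when the other
points of the internal triangle are known, and is skipped otherwise; so one
list of steps can serve several starting sets. *)
Definition derive_step (base : pred pt) (known : seq pt)
    (s : pt * pt * pt) : seq pt :=
  let: (p, u, v) := s in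
  let kn z := base z || (z \in known) in
  if [&& `|u.1 * v.2 - u.2 * v.1| == 1, kn (p + u) & kn (p + v)] then
    if kn p then (p - u - v) :: known
    else if kn (p - u - v) then p :: known else known
  else known.

Definition derive (base : pred pt) := foldl (derive_step base).

(** Turns a computed derivation into membership in [Q]; [base] carries a possibly infinite decidable
    part of [Q], [known] a finite one. *)
Lemma derive_sound (Q : set pt) (base : pred pt) (known : seq pt) steps :
  internal_closed Q -> (forall z, base z -> Q z) ->
  {in known, forall z, Q z} -> {in derive base known steps, forall z, Q z}.
Proof.
move=> cQ bQ; elim: steps known => [//|[[p u] v] steps IHs] known kQ /=.
apply: IHs; rewrite /derive_step.
have knQ z : base z || (z \in known) -> Q z by case/orP=> [/bQ|/kQ].
case: ifP => // /and3P[/eqP uv /knQ Qu /knQ Qv].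
have [out ctr] := cQ p u v uv.
case: ifP => [/knQ Qp|_] z.
  by rewrite inE => /predU1P[->|/kQ//]; exact: out.
case: ifP => [/knQ Qw|_ /kQ//].
by rewrite inE => /predU1P[->|/kQ//]; exact: ctr.
Qed.

Definition star : seq pt := [:: (0, 0); (1, 0); (0, 1); (-1, -1)].

(* Membership in [J_quarter], read off modulo 4: [3] stands for [-1]. *)
Definition star4 (z : pt) : bool :=
  ((z.1 %% 4)%Z, (z.2 %% 4)%Z) \in [:: (0, 0); (1, 0); (0, 1); (3, 3)].

Lemma internal_closedD (Q : set pt) (t : pt) :
  internal_closed Q -> internal_closed [set z | Q (t + z)].
Proof. by move=> cQ p u v uv; have := cQ (t + p) u v uv; rewrite /= !addrA. Qed.

(* The lists of steps were found by computer search. *)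
Definition translate_steps : seq (pt * pt * pt) := [::
  ((1, 0), (-1, 0), (-2, -1));
  ((1, 0), (-1, 0), (-1, 1));
  ((-1, -1), (1, 1), (2, 1));
  ((0, 0), (-1, -1), (-4, -3));
  ((4, 1), (-1, -2), (1, 3));
  ((0, 0), (1, 0), (3, -1));
  ((1, 0), (-1, 0), (-5, 1));
  ((4, 0), (-4, 1), (3, -1));
  ((0, 1), (0, -1), (-1, -2));
  ((0, 1), (0, -1), (1, -1));
  ((-1, -1), (1, 1), (1, 2));
  ((0, 0), (-1, -1), (-3, -4));
  ((1, 4), (-2, -1), (3, 1));
  ((0, 0), (0, 1), (-1, 3));
  ((0, 1), (0, -1), (1, -5));
  ((0, 4), (1, -4), (-1, 3));
  ((0, 0), (0, 1), (1, 4));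
  ((-3, -4), (-1, 1), (2, -1));
  ((-1, -1), (1, 1), (6, 5));
  ((-4, -4), (5, 4), (-4, -3))].

(** The three vectors sum to zero, so their nonnegative combinations fill the lattice and no inverse
    translation has to be derived. *)
Lemma derive_star_translate :
  all (fun e : pt => all [in derive pred0 star translate_steps]
                         [seq e *+ 4 + z | z <- star])
      [:: (1, 0); (0, 1); (-1, -1)].
Proof. by vm_compute. Qed.

Definition spread_steps : seq (pt * pt * pt) := [::
  ((1, 0), (1, 1), (-1, 0));
  ((1, 0), (0, -1), (-1, 1));
  ((0, 1), (1, 1), (0, -1));
  ((-1, 3), (1, 0), (-2, 1));
  ((0, 1), (-1, 0), (1, -1));
  ((-3, -3), (1, 1), (0, -1));
  ((-2, -1), (1, -1), (1, 0));
  ((-3, -3), (1, 2), (0, -1));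
  ((-1, -2), (-2, -1), (5, 2));
  ((-2, -1), (-1, -2), (2, 5));
  ((0, 1), (2, -1), (-5, 2));
  ((0, 1), (3, -1), (-5, 2));
  ((2, 1), (1, -1), (1, -2));
  ((1, -1), (2, 1), (3, 1));
  ((-1, 3), (1, -1), (-2, 1));
  ((-1, 1), (1, 1), (1, 0));
  ((0, 1), (-1, 0), (0, -1));
  ((-2, -2), (-1, -1), (2, 3))].

(* [2 e1], [2 e2] and [2 e3]. *)
Definition shifts : seq pt := [:: (2, 0); (0, 2); (-2, -2)].

(** One list serves all twelve choices of a shift [s] and a known point [s + r], and fills the star
    around [s]. *)
Lemma derive_spread :
  all (fun s : pt => all (fun r => all [in derive star4 [:: s + r] spread_steps]
                       [seq s + z | z <- star]) star) shifts.
Proof. by vm_compute. Qed.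

Definition third_steps : seq (pt * pt * pt) := [::
  ((-1, -2), (-4, -3), (1, 1));
  ((-2, -1), (-3, -4), (1, 1));
  ((-4, -3), (-1, -1), (-1, 0))].

(** A single point of the missing class is enough, as [star4_shift_sub] then supplies the rest. *)
Lemma derive_third :
  all (fun s => has (fun z => star4 (z - s))
         (derive (fun z => star4 z ||
                    has (fun t => (t != s) && star4 (z - t)) shifts)
            [::] third_steps))
      shifts.
Proof. by vm_compute. Qed.

Lemma pair_mulr4 (q : pt) : q *+ 4 = (q.1 * 4, q.2 * 4).
Proof. by case: q => a b; rewrite !(mulr_natr _ 4) !mulrS !mulr0n. Qed.

Lemma star4_addM4 (q z : pt) : star4 (q *+ 4 + z) = star4 z.
Proof. by rewrite pair_mulr4 /star4 /= !modzMDl. Qed.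

(** Reduces claims about classes modulo 4 to sixteen residues, which computation decides. *)
Lemma div4P (z : pt) : exists q r : pt,
  z = q *+ 4 + r /\
  r \in [seq (i, j) | i <- [:: 0; 1; 2; 3], j <- [:: 0; 1; 2; 3]].
Proof.
have mod4 (x : int) : (x %% 4)%Z \in [:: 0; 1; 2; 3].
  by have := modz_ge0 x (isT : 4 != 0 :> int);
     have := @ltz_pmod x 4 isT; rewrite !inE; lia.
case: z => x y; exists ((x %/ 4)%Z, (y %/ 4)%Z), ((x %% 4)%Z, (y %% 4)%Z).
split; first by rewrite pair_mulr4 {1}(divz_eq x 4) {1}(divz_eq y 4).
by apply: allpairs_f; exact: mod4.
Qed.

Lemma star4P (z : pt) :
  star4 z -> exists q r : pt, r \in star /\ z = q *+ 4 + r.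
Proof.
have [q [r [-> rs]]] := div4P z; rewrite star4_addM4.
(* Only the residue [(3, 3)] needs correcting: subtracting [1 *+ 4], the pair [(4, 4)], turns it
   into [(-1, -1)]. *)
have : star4 r ==> (r \in star) || (r - 1 *+ 4 \in star).
  by move: r rs; apply/allP; vm_compute.
move=> /implyP sr /sr /orP[] rz; first by exists q, r.
by exists (q + 1), (r - 1 *+ 4); rewrite mulrnDl addrACA subrr addr0.
Qed.

Lemma star4_cover (z : pt) : star4 z || has (fun s => star4 (z - s)) shifts.
Proof.
have [q [r [-> rs]]] := div4P z.
rewrite star4_addM4.
rewrite (eq_has (a2 := fun s => star4 (r - s))); last first.
  by move=> s; rewrite -addrA star4_addM4.
move: r rs; apply/allP.
by vm_compute.
Qed.

Lemma star4_sub (Q : set pt) : internal_closed Q -> {in star, forall z, Q z} ->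
  forall z, star4 z -> Q z.
Proof.
move=> cQ sQ z /star4P[q [r [rs ->]]].
pose P (q : pt) := {in star, forall z : pt, Q (q *+ 4 + z)}.
suff: P q by exact.
have Pe (e q' : pt) : e \in [:: (1, 0); (0, 1); (-1, -1)] -> P q' -> P (e + q').
  move=> ee Pq' w ws; rewrite mulrnDl addrAC addrC.
  apply: (derive_sound (internal_closedD (q' *+ 4) cQ) (base := pred0) _ Pq').
    by [].
  exact: (allP (allP derive_star_translate e ee)) (map_f _ ws).
have P1 q' : P q' -> P ((1, 0) + q') by exact: Pe.
have P2 q' : P q' -> P ((0, 1) + q') by exact: Pe.
have P3 q' : P q' -> P ((-1, -1) + q') by exact: Pe.
(* A negative step is the sum of the two other vectors. *)
have P1N q' : P q' -> P ((-1, 0) + q').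
  by move=> /P3 /P2; rewrite addrA.
have P2N q' : P q' -> P ((0, -1) + q').
  by move=> /P3 /P1; rewrite addrA.
have addE (x y x' y' : int) : (x, y) + (x', y') = (x + x', y + y') :> pt by [].
case: q => x y.
have Px : P (x, 0).
  elim/int_rect: x => [|n /P1|n /P1N].
  - by move=> w ws; rewrite mul0rn add0r; exact: sQ.
  - by rewrite addE intS.
  - by rewrite addE intS opprD.
elim/int_rect: y => [//|n /P2|n /P2N].
  by rewrite addE intS add0r.
by rewrite addE intS opprD add0r.
Qed.

(** With [q *+ 4] as origin the known point is [s + r], and [derive_spread] yields the star centred
    at [s]; [star4_sub], recentred there, gives the whole class. *)
Lemma star4_shift_sub (Q : set pt) (s z0 : pt) :
  internal_closed Q -> (forall z, star4 z -> Q z) -> s \in shifts ->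
  Q z0 -> star4 (z0 - s) -> forall z, star4 (z - s) -> Q z.
Proof.
move=> cQ JQ ss Qz0 /star4P[q [r [rs z0E]]] z sz.
have starQ : {in star, forall w, Q (q *+ 4 + s + w)}.
  move=> w ws; rewrite -addrA.
  apply: (derive_sound (internal_closedD (q *+ 4) cQ) (base := star4)
            (known := [:: s + r]) (steps := spread_steps)).
  - by move=> w' sw' /=; apply: JQ; rewrite star4_addM4.
  - by move=> w'; rewrite inE => /eqP -> /=; rewrite addrCA -z0E subrKC.
  - exact: (allP (allP (allP derive_spread s ss) r rs)) (map_f _ ws).
have -> : z = q *+ 4 + s + (z - s - q *+ 4) by rewrite addrC addrA !subrK.
apply: (star4_sub (internal_closedD (q *+ 4 + s) cQ) starQ).
by rewrite addrC -mulNrn star4_addM4.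
Qed.

Lemma internal_closed_cases (Q : set pt) :
  internal_closed Q -> {in star, forall z, Q z} ->
  [\/ forall z, Q z <-> star4 z,
      exists2 s, s \in shifts & forall z, Q z <-> star4 z || star4 (z - s) |
      forall z, Q z].
Proof.
move=> cQ /(star4_sub cQ) JQ.
(* [F s] says that [Q] meets the class of [s]; the cases are no class, exactly one, and at least
   two. *)
pose F s := exists2 z, Q z & star4 (z - s).
have FQ s : s \in shifts -> F s -> forall z, star4 (z - s) -> Q z.
  by move=> ss [z0 Qz0 sz0]; exact: star4_shift_sub Qz0 sz0.
have [all0|/existsNP[s /not_implyP[ss /contrapT Fs]]] :=
  pselect (forall s, s \in shifts -> ~ F s).
  constructor 1 => z; split=> [Qz|]; last exact: JQ.
  have /orP[//|/hasP[s ss sz]] := star4_cover z.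
  by case: (all0 s ss); exists z.
have [one|/existsNP[t /not_implyP[ts /not_implyP[/eqP tNs /contrapT Ft]]]] :=
  pselect (forall t, t \in shifts -> t <> s -> ~ F t).
  constructor 2; exists s; first exact: ss.
  move=> z; split=> [Qz|/orP[]]; [|exact: (JQ z)|exact: (FQ s ss Fs z)].
  apply/orP; have /orP[|/hasP[t ts tz]] := star4_cover z; first by left.
  have [<-|/eqP tNs] := eqVneq t s; first by right.
  by case: (one t ts tNs); exists z.
constructor 3 => z.
have FF r : r \in shifts -> F r.
  move=> rs; have [->//|rNs] := eqVneq r s; have [->//|rNt] := eqVneq r t.
  have /hasP[w wd wr] := allP derive_third r rs.
  exists w; last exact: wr.
  apply: (derive_sound cQ _ _ wd) => [z'|z']; last by rewrite in_nil.
  case/orP=> [|/hasP[r' r's /andP[r'Nr]]]; [exact: (JQ z')|].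
  suff [->|->] : r' = s \/ r' = t;
    [exact: (FQ s ss Fs z')|exact: (FQ t ts Ft z')|].
  move: ss ts rs r's tNs rNs rNt r'Nr; rewrite !inE.
  by do 4! case/or3P => /eqP ->; rewrite ?eqxx //; auto.
have /orP[|/hasP[r rs]] := star4_cover z; first exact: JQ.
exact: (FQ r rs (FF r rs) z).
Qed.

(** * Minimal lattice triangles *)

(** For [0 < orient a b c] these are the lattice points of the real triangle, described within the
    integers. *)
Definition in_tri (a b c : Z2) : set Z2 :=
  [set x | [/\ 0 <= orient x b c, 0 <= orient a x c & 0 <= orient a b x]].

Lemma in_tri_rot (a b c : Z2) : in_tri b c a = in_tri a b c.
Proof.
apply/seteqP; split=> x; rewrite /in_tri /=.
all: by rewrite (orient_rot a x c) (orient_rot a b x) (orient_rot x b c) => -[].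
Qed.

Lemma in_tri_vertices (a b c : Z2) : 0 < orient a b c ->
  [/\ in_tri a b c a, in_tri a b c b & in_tri a b c c].
Proof.
by move=> d0; split; split; rewrite ?orientaac ?orientaba ?orientabb ?lexx ?ltW.
Qed.

(* Reduce a lattice vector modulo the lattice spanned by the edges at [a]: the
representative in the fundamental parallelogram, or its reflection, lies in the
triangle; so the edges span [Z2]. *)
Lemma in_tri_empty (a b c : Z2) :
  0 < orient a b c -> in_tri a b c `<=` [set` [:: a; b; c]] -> orient a b c = 1.
Proof.
move=> d0 empty; set d := orient a b c in d0 *.
pose u := b - a; pose v := c - a.
have small (y : Z2) : 0 <= det2 y v < d -> 0 <= det2 u y < d ->
    det2 y v + det2 u y <= d -> det2 y v = 0 /\ det2 u y = 0.
  move=> /andP[m0 md] /andP[n0 nd] mn.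
  have /empty : in_tri a b c (a + y).
    split; [suff -> : orient (a + y) b c = d - (det2 y v + det2 u y) by lia
           |suff -> : orient a (a + y) c = det2 y v by []
           |suff -> : orient a b (a + y) = det2 u y by []];
    by rewrite /d !orientE /det2 !mxE; ring.
  have mE : orient a (a + y) c = det2 y v by rewrite orientE /det2 !mxE; ring.
  have nE : orient a b (a + y) = det2 u y by rewrite orientE /det2 !mxE; ring.
  rewrite /= !inE => /or3P[] /eqP e; move: mE nE; rewrite e
    ?orientaac ?orientaba ?orientabb -/d; lia.
have dvd_det (y : Z2) : (d %| det2 y v)%Z /\ (d %| det2 u y)%Z.
  pose m := (det2 y v %% d)%Z; pose n := (det2 u y %% d)%Z.
  pose y' := y - (det2 y v %/ d)%Z *: u - (det2 u y %/ d)%Z *: v.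
  have dE : d = det2 u v by [].
  have mE : det2 y' v = m.
    rewrite /m /modz.
    move: (det2 y v %/ d)%Z (det2 u y %/ d)%Z @y' => k l y'.
    by rewrite dE /det2 !mxE; ring.
  have nE : det2 u y' = n.
    clear mE; rewrite /n /modz.
    move: (det2 y v %/ d)%Z (det2 u y %/ d)%Z @y' => k l y'.
    by rewrite dE /det2 !mxE; ring.
  have m0 : 0 <= m by rewrite modz_ge0 // gt_eqF.
  have n0 : 0 <= n by rewrite modz_ge0 // gt_eqF.
  have md : m < d by rewrite ltz_pmod.
  have nd : n < d by rewrite ltz_pmod.
  have [mn|mn] := lerP (m + n) d.
    have [] := small y'; rewrite ?mE ?nE ?m0 ?n0 //.
    by move=> m00 n00; split; apply/dvdz_mod0P.
  have mE' : det2 (u + v - y') v = d - m.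
    by rewrite -mE dE /det2 !mxE; ring.
  have nE' : det2 u (u + v - y') = d - n.
    by rewrite -nE dE /det2 !mxE; ring.
  by have := small (u + v - y'); rewrite mE' nE'; lia.
(* The two unit vectors show that [d] divides every coordinate of both edges; hence the square of
   [d] divides [d]. *)
have [/dvdzP[v1 v1E] /dvdzP[u1 u1E]] := dvd_det (vec2 1 0).
have [/dvdzP[v0 v0E] /dvdzP[u0 u0E]] := dvd_det (vec2 0 1).
move: v1E u1E v0E u0E; rewrite /det2 !mxE /= !(mul0r, mulr0, mul1r, mulr1).
rewrite !(subr0, sub0r) => v1E u1E v0E u0E.
have dE : d = u 0 0 * v 1 0 - u 1 0 * v 0 0 by [].
have : d * (d * (u0 * v1 - u1 * v0)) = d * 1.
  rewrite mulr1 [RHS]dE !mxE v1E u0E.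
  have -> : b 1 0 - a 1 0 = - (u1 * d) by lia.
  have -> : c 0 0 - a 0 0 = - (v0 * d) by lia.
  ring.
move=> /(mulfI (lt0r_neq0 d0)) dk.
have : (d %| 1)%Z by apply/dvdzP; exists (u0 * v1 - u1 * v0); rewrite mulrC dk.
by rewrite dvdz1; move: d0; clear; lia.
Qed.

(** The coordinates of [x] in [a b c] combine those of [x] in [p b c] and of [p] in [a b c] with
    nonnegative weights; the factor [orient p b c] clears denominators. *)
Lemma in_tri_sub (a b c p x : Z2) : 0 < orient a b c -> in_tri a b c p ->
  0 < orient p b c -> in_tri p b c x -> in_tri a b c x.
Proof.
move=> d0 [p1 p2 p3] a0 [x1 x2 x3]; split => //.
  rewrite -(pmulr_rge0 _ a0).
  suff -> : orient p b c * orient a x c =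
     orient x b c * orient a p c + orient p x c * orient a b c.
    by rewrite addr_ge0 // mulr_ge0 // ltW.
  by rewrite !orientE; ring.
rewrite -(pmulr_rge0 _ a0).
suff -> : orient p b c * orient a b x =
   orient x b c * orient a b p + orient p b x * orient a b c.
  by rewrite addr_ge0 // mulr_ge0 // ltW.
by rewrite !orientE; ring.
Qed.

Lemma orient_vertex (a b c p : Z2) : 0 < orient a b c ->
  orient a p c = 0 -> orient a b p = 0 -> p = a.
Proof.
move=> d0 be0 ga0.
have dE : orient p b c = orient a b c.
  by rewrite -(orient_split a b c p) be0 ga0 !addr0.
have := orient_bary a b c p; rewrite be0 ga0 dE !scale0r !addr0 => pE.
by apply: cV2_eq; apply: (mulfI (lt0r_neq0 d0));
  move/matrixP: pE => /(_ _ 0) pE; [have := pE 0|have := pE 1]; rewrite !mxE.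
Qed.

(** A nondegenerate piece [p b c] is empty: it lies in the whole triangle, and if it contained [a],
    then [p] would be [a]. So [in_tri_empty] applies. *)
Lemma in_tri_area (a b c p : Z2) : 0 < orient a b c ->
  in_tri a b c = [set` [:: p; a; b; c]] -> p != a ->
  orient p b c = 0 \/ orient p b c = 1.
Proof.
move=> d0 TE pa.
have Tp : in_tri a b c p by rewrite TE /= mem_head.
have [p1 p2 p3] := Tp.
have [a0|] := ltrP 0 (orient p b c); last by left; lia.
right; apply: in_tri_empty => // x xT.
have := in_tri_sub d0 Tp a0 xT; rewrite TE /= !inE.
case/or4P=> /eqP xE; rewrite xE ?eqxx ?orbT //.
case/eqP: pa; apply: (orient_vertex d0).
  move: xT => [_ + _]; rewrite xE.
  have -> : orient p a c = - orient a p c by rewrite !orientE; ring.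
  lia.
move: xT => [_ _]; rewrite xE.
have -> : orient p b a = - orient a b p by rewrite !orientE; ring.
lia.
Qed.

(** * Lattice frames of determinant one and the two shapes of minimal triangles *)

Definition frame (p u v : Z2) (z : pt) : Z2 := p + z.1 *: u + z.2 *: v.

Definition border_star : seq pt := [:: (0, 0); (1, 0); (-1, 0); (0, 1)].

Definition quad (s : seq pt) (p u v : Z2) : set Z2 :=
  [set` [seq frame p u v z | z <- s]].

Lemma frame_orient p u v x y z :
  orient (frame p u v x) (frame p u v y) (frame p u v z) =
  det2 u v * ((y.1 - x.1) * (z.2 - x.2) - (y.2 - x.2) * (z.1 - x.1)).
Proof. by rewrite orientE /det2 /frame !mxE; ring. Qed.

(** Cramer's rule with determinant one. *)
Lemma frame_coord p u v x : det2 u v = 1 ->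
  x = frame p u v (det2 (x - p) v, det2 u (x - p)).
Proof.
move=> uv.
have xE i : x i 0 = p i 0 + det2 u v * (x i 0 - p i 0).
  by rewrite uv mul1r addrC subrK.
by apply: cV2_eq; rewrite xE /frame /det2 !mxE /=; ring.
Qed.

Lemma frame_inj p u v : det2 u v = 1 -> injective (frame p u v).
Proof.
move=> uv.
apply: (can_inj (g := fun x => (det2 (x - p) v, det2 u (x - p)))) => -[s t].
by congr pair; rewrite -[RHS]mulr1 -uv /frame /det2 !mxE /=; ring.
Qed.

Lemma quad_card s p u v : det2 u v = 1 -> uniq s -> quad s p u v #= `I_(size s).
Proof.
move=> uv us; rewrite -(size_map (frame p u v)); apply: card_eq_seq.
by rewrite map_inj_uniq //; exact: frame_inj.
Qed.

Lemma in_tri_internal p u v : det2 u v = 1 ->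
  in_tri (frame p u v (1, 0)) (frame p u v (0, 1)) (frame p u v (-1, -1)) =
  quad star p u v.
Proof.
move=> uv; apply/seteqP; split=> x; rewrite /quad; last first.
  move=> xs.
  have /mapP[z zs ->] : x \in [seq frame p u v z | z <- star] := xs.
  rewrite /in_tri /= !frame_orient uv !mul1r.
  by apply/and3P; move: z zs; apply/allP.
rewrite (frame_coord p x uv); move: (det2 _ v) (det2 u _) => s t.
move=> xT; suff : (s, t) \in star by exact: (map_f (frame p u v)).
move: xT; rewrite /in_tri /= !frame_orient uv !mul1r /= => -[x1 x2 x3].
by rewrite !inE !xpair_eqE; lia.
Qed.

Lemma in_tri_border p u v : det2 u v = 1 ->
  in_tri (frame p u v (1, 0)) (frame p u v (0, 1)) (frame p u v (-1, 0)) =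
  quad border_star p u v.
Proof.
move=> uv; apply/seteqP; split=> x; rewrite /quad; last first.
  move=> xs.
  have /mapP[z zs ->] : x \in [seq frame p u v z | z <- border_star] := xs.
  rewrite /in_tri /= !frame_orient uv !mul1r.
  by apply/and3P; move: z zs; apply/allP.
rewrite (frame_coord p x uv); move: (det2 _ v) (det2 u _) => s t.
move=> xT; suff : (s, t) \in border_star by exact: (map_f (frame p u v)).
move: xT; rewrite /in_tri /= !frame_orient uv !mul1r /= => -[x1 x2 x3].
by rewrite !inE !xpair_eqE; lia.
Qed.

(** Each of the three pieces at [p] has doubled area 0 or 1. Two zeros force [p] to be a vertex, one
    zero makes it the midpoint of a side, and no zero makes it the centroid. *)
Lemma minimal_in_tri_cases (a b c p : Z2) : 0 < orient a b c ->
  in_tri a b c #= `I_4 -> in_tri a b c p -> p \notin [:: a; b; c] ->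
  ([/\ 0 < orient p b c, 0 < orient a p c & 0 < orient a b p] /\
    exists u v, det2 u v = 1 /\ in_tri a b c = quad star p u v) \/
  (~ [/\ 0 < orient p b c, 0 < orient a p c & 0 < orient a b p] /\
    exists u v, det2 u v = 1 /\ in_tri a b c = quad border_star p u v).
Proof.
move=> d0 T4 Tp pN; have [Ta Tb Tc] := in_tri_vertices d0.
have ab : a != b by apply/eqP => e; move: d0; rewrite e orientaac.
have ac : a != c by apply/eqP => e; move: d0; rewrite e orientaba.
have bc : b != c by apply/eqP => e; move: d0; rewrite e orientabb.
have TE : in_tri a b c = [set` [:: p; a; b; c]].
  apply: card_eq_seq_eq => //.
    by rewrite cons_uniq pN /= !inE negb_or ab ac bc.
  by move=> x; rewrite /= !inE => /or4P[] /eqP ->.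
have d1 : 0 < orient b c a by rewrite orient_rot.
have d2 : 0 < orient c a b by rewrite orient_rot.
have TE1 : in_tri b c a = [set` [:: p; b; c; a]].
  rewrite in_tri_rot TE; apply/seteqP; split=> x /=; rewrite !inE;
  by case/or4P=> ->; rewrite ?orbT.
have TE2 : in_tri c a b = [set` [:: p; c; a; b]].
  rewrite in_tri_rot TE1; apply/seteqP; split=> x /=; rewrite !inE;
  by case/or4P=> ->; rewrite ?orbT.
move: pN; rewrite !inE !negb_or => /and3P[pa pb pc].
have border (x y z : Z2) : in_tri x y z = [set` [:: p; x; y; z]] ->
    orient p y z = 0 -> orient x p z = 1 -> orient x y p = 1 ->
    exists u v, det2 u v = 1 /\ in_tri x y z = quad border_star p u v.
  (* Equal pieces make [p] the midpoint of [y z]; the frame runs from [p] to [z] and to the apex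
     [x]. *)
  move=> {}TE al be ga; exists (z - p), (x - p); split.
    by rewrite -[RHS]be -orient_rot.
  have dE : orient x y z = 2 by rewrite -(orient_split x y z p) al be ga.
  have := orient_bary x y z p; rewrite al be ga dE scale0r add0r !scale1r => pE.
  have yE : y = p - (z - p).
    by rewrite opprB addrA -mulr2n -scaler_nat pE addrK.
  rewrite TE /quad /frame /= !scale0r !scale1r !addr0 scaleN1r -yE !subrKC.
  by apply/seteqP; split=> w /=; rewrite !inE => /or4P[] ->; rewrite ?orbT.
have r1 : orient p c a = orient a p c by rewrite !orientE; ring.
have r2 : orient p a b = orient a b p by rewrite !orientE; ring.
have r3 : orient b p a = orient a b p by rewrite !orientE; ring.
have r4 : orient b c p = orient p b c by rewrite !orientE; ring.
have r5 : orient c p b = orient p b c by rewrite !orientE; ring.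
have r6 : orient c a p = orient a p c by rewrite !orientE; ring.
have := in_tri_area d2 TE2 pc; have := in_tri_area d1 TE1 pb.
have := in_tri_area d0 TE pa; rewrite r1 r2.
case=> al; case=> be; case=> ga; rewrite al be ga.
- by case/eqP: pa; apply: (orient_vertex d0).
- by case/eqP: pc; apply: (orient_vertex d2); rewrite ?r5 ?r6.
- by case/eqP: pb; apply: (orient_vertex d1); rewrite ?r3 ?r4.
- by right; split; [case|apply: border].
- by case/eqP: pa; apply: (orient_vertex d0).
- right; split; first by case.
  by rewrite -in_tri_rot; apply: border; rewrite ?r1 ?r3 ?r4.
- right; split; first by case.
  by rewrite -2!in_tri_rot; apply: border; rewrite ?r2 ?r5 ?r6.
left; split=> //; exists (a - p), (b - p); split; first by rewrite -[RHS]ga -r2.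
have dE : orient a b c = 3 by rewrite -(orient_split a b c p) al be ga.
have := orient_bary a b c p; rewrite al be ga dE !scale1r => pE.
have cE : c = p - (a - p) - (b - p).
  have -> : p - (a - p) - (b - p) = 3 *: p - a - b.
    by apply: cV2_eq; rewrite !mxE; ring.
  by rewrite pE; apply: cV2_eq; rewrite !mxE; ring.
rewrite TE /quad /frame /= !scale0r !scale1r !addr0 !scaleN1r -cE !subrKC.
by [].
Qed.

(** * From real triangles to integer frames *)

Section Classification.
Variable R : realType.
Implicit Types a b c p u v x : Z2.

Lemma toR2_image3 a b c :
  toR2 R @` [set a; b; c] = [set toR2 R a; toR2 R b; toR2 R c].
Proof. by rewrite !image_setU !image_set1. Qed.

Lemma toR2_orient a b c :
  orient (toR2 R a) (toR2 R b) (toR2 R c) = (orient a b c)%:~R.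
Proof. by rewrite !orientE !mxE -!rmorphB -!rmorphM -rmorphB. Qed.

Lemma collinear_orient a b c :
  collinear (toR2 R @` [set a; b; c]) <-> orient a b c = 0.
Proof.
rewrite toR2_image3; split=> [[q [v [_ sub]]]|d0].
  have [s _ aE] : line q v (toR2 R a) by apply: sub; left; left.
  have [t _ bE] : line q v (toR2 R b) by apply: sub; left; right.
  have [r _ cE] : line q v (toR2 R c) by apply: sub; right.
  apply/eqP; rewrite -(@intr_eq0 R) -toR2_orient -aE -bE -cE orientE !mxE.
  by apply/eqP; ring.
have := toR2_orient a b c; rewrite d0 /=.
move: (toR2 R a) (toR2 R b) (toR2 R c) => {d0} A B C; rewrite orientE mulr0z.
move=> /eqP; rewrite subr_eq0 => /eqP dE.
have seg (X Y Z : 'cV[R]_2) i : Y i 0 - X i 0 != 0 ->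
    (forall j, (Y i 0 - X i 0) * (Z j 0 - X j 0) =
               (Y j 0 - X j 0) * (Z i 0 - X i 0)) ->
    collinear [set X; Y; Z].
  move=> n0 e; exists X, (Y - X); split.
    by apply/eqP => /matrixP/(_ i 0); rewrite !mxE => /eqP; rewrite (negPf n0).
  move=> _ [[->|->]|->].
  - by exists 0 => //; rewrite scale0r addr0.
  - by exists 1 => //; rewrite scale1r subrKC.
  exists ((Z i 0 - X i 0) / (Y i 0 - X i 0)) => //.
  apply/matrixP => j k; rewrite (ord1 k) !mxE mulrAC (mulrC (_ - _)) -e.
  by rewrite mulrAC divff // mul1r subrKC.
have ord2 (i : 'I_2) : i = 0 \/ i = 1.
  by case: i => -[|[|//]] ?; [left|right]; apply/val_inj.
have [b0|b0] := eqVneq (B 0 0 - A 0 0) 0; last first.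
  apply: (seg A B C 0 b0) => j; have [->//|->] := ord2 j; exact: dE.
have [b1|b1] := eqVneq (B 1 0 - A 1 0) 0; last first.
  by apply: (seg A B C 1 b1) => j; have [->|->//] := ord2 j; rewrite dE.
have BA : B = A by apply: cV2_eq; apply/eqP; rewrite -subr_eq0 ?b0 ?b1.
have sub (v : 'cV[R]_2) : line A v A by exists 0 => //; rewrite scale0r addr0.
have [CA|CA] := eqVneq (C - A) 0; last first.
  exists A, (C - A); split => // _ [[->|->]|->]; rewrite ?BA //.
  by exists 1 => //; rewrite scale1r subrKC.
have -> : C = A by apply/eqP; rewrite -subr_eq0 CA.
(* All three points coincide, so any nonzero direction serves. *)
exists A, (const_mx 1); split; last by move=> _ [[->|->]|->]; rewrite ?BA.
by apply/eqP => /matrixP/(_ 0 0); rewrite !mxE => /eqP; rewrite oner_eq0.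
Qed.

Lemma lattice_points_hull a b c : 0 < orient a b c ->
  lattice_points (convex_hull (toR2 R @` [set a; b; c])) = in_tri a b c.
Proof.
move=> d0; have D0 : 0 < orient (toR2 R a) (toR2 R b) (toR2 R c).
  by rewrite toR2_orient ltr0z.
rewrite toR2_image3; apply/seteqP; split=> x.
  by move=> /(convex_hull3P _ D0); rewrite !toR2_orient !ler0z.
by move=> xT; apply/(convex_hull3P _ D0); rewrite !toR2_orient !ler0z.
Qed.

Lemma interior_lattice_hull a b c x : 0 < orient a b c ->
  interior (convex_hull (toR2 R @` [set a; b; c])) (toR2 R x) <->
  [/\ 0 < orient x b c, 0 < orient a x c & 0 < orient a b x].
Proof.
move=> d0; have D0 : 0 < orient (toR2 R a) (toR2 R b) (toR2 R c).
  by rewrite toR2_orient ltr0z.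
by rewrite toR2_image3 (interior_hull3P _ D0) !toR2_orient !ltr0z.
Qed.

(** Exchanging two vertices reverses the orientation and keeps the vertex set. *)
Lemma lattice_triangle_pos a b c D : lattice_triangle_with a b c D ->
  exists a' b' c', [/\ 0 < orient a' b' c', [set a'; b'; c'] = [set a; b; c] &
    D = convex_hull (toR2 R @` [set a'; b'; c'])].
Proof.
move=> [/collinear_orient ncol DE].
have [d0|d0] : 0 < orient a b c \/ 0 < orient a c b.
  by rewrite [orient a c b]orient_swap; lia.
  by exists a, b, c.
by exists a, c, b; split=> //; rewrite ?DE; rewrite setUAC.
Qed.

Lemma lattice_triangle_hull a b c : 0 < orient a b c ->
  lattice_triangle_with a b c (convex_hull (toR2 R @` [set a; b; c])).
Proof. by move=> d0; split=> // /collinear_orient d00; rewrite d00 in d0. Qed.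

Lemma minimal_triangle_cases (T : set Z2) a b c D p :
  T #= `I_4 -> lattice_triangle_with a b c D -> T = lattice_points D ->
  (T `\` [set a; b; c]) p ->
  (interior D (toR2 R p) /\
     exists u v, det2 u v = 1 /\ T = quad star p u v) \/
  (~ interior D (toR2 R p) /\
     exists u v, det2 u v = 1 /\ T = quad border_star p u v).
Proof.
move=> T4 /lattice_triangle_pos[a' [b' [c' [d0 <- ->]]]].
rewrite lattice_points_hull // => TE; rewrite {}TE in T4 *.
move=> [Tp pN]; rewrite interior_lattice_hull //.
apply: minimal_in_tri_cases => //.
by apply/negP; rewrite !inE => /or3P[]/eqP pE; apply: pN; rewrite pE /=; tauto.
Qed.

(** Replaces real convexity by integer frames, in which the stability arguments are carried out. *)
Lemma border_triangleP (T : set Z2) : border_triangle R T <->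
  exists p u v, det2 u v = 1 /\ T = quad border_star p u v.
Proof.
split.
  move=> [[_ T4] [a [b [c [D [p [tri TE Tp [_ bp]]]]]]]].
  have [[/bp//]|[_ [u [v uvT]]]] := minimal_triangle_cases T4 tri TE Tp.
  by exists p, u, v.
move=> [p [u [v [uv ->]]]].
set a := frame p u v (1, 0); set b := frame p u v (0, 1).
set c := frame p u v (-1, 0).
have d0 : 0 < orient a b c by rewrite frame_orient uv.
have TE : quad border_star p u v =
    lattice_points (convex_hull (toR2 R @` [set a; b; c])).
  by rewrite lattice_points_hull // in_tri_border.
have tri := lattice_triangle_hull d0.
split.
  split; last by have := @quad_card border_star p u v uv isT.
  by exists a, b, c; eexists; split; first exact: tri.
exists a, b, c; eexists; exists (frame p u v (0, 0)).
split; [exact: tri|exact: TE| |].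
  split; first by rewrite /quad /= mem_head.
  by move=> [[]|] /(frame_inj uv).
split.
  apply: subset_closure.
  have : quad border_star p u v (frame p u v (0, 0)) by rewrite /quad /= mem_head.
  by rewrite TE.
(* The point lies on the side [a c], so one strict inequality fails. *)
by rewrite interior_lattice_hull // !frame_orient uv => -[].
Qed.

Lemma internal_triangleP (T : set Z2) : internal_triangle R T <->
  exists p u v, det2 u v = 1 /\ T = quad star p u v.
Proof.
split.
  move=> [[_ T4] [a [b [c [D [p [tri TE Tp ip]]]]]]].
  have [[_ [u [v uvT]]]|[/(_ ip)//]] := minimal_triangle_cases T4 tri TE Tp.
  by exists p, u, v.
move=> [p [u [v [uv ->]]]].
set a := frame p u v (1, 0); set b := frame p u v (0, 1).
set c := frame p u v (-1, -1).
have d0 : 0 < orient a b c by rewrite frame_orient uv.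
have TE : quad star p u v =
    lattice_points (convex_hull (toR2 R @` [set a; b; c])).
  by rewrite lattice_points_hull // in_tri_internal.
have tri := lattice_triangle_hull d0.
split.
  split; last by have := @quad_card star p u v uv isT.
  by exists a, b, c; eexists; split; first exact: tri.
exists a, b, c; eexists; exists (frame p u v (0, 0)).
split; [exact: tri|exact: TE| |].
  split; first by rewrite /quad /= mem_head.
  by move=> [[]|] /(frame_inj uv).
by rewrite interior_lattice_hull // !frame_orient uv.
Qed.

Lemma minimal_triangle_border_or_internal (T : set Z2) :
  minimal_triangle R T -> border_triangle R T \/ internal_triangle R T.
Proof.
move=> [tT T4]; have [a [b [c [D [tri TE]]]]] := tT.
suff [p Tp] : exists p, (T `\` [set a; b; c]) p.
  have [[ip _]|[nip _]] := minimal_triangle_cases T4 tri TE Tp; [right|left].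
    by split=> //; exists a, b, c, D, p.
  split=> //; exists a, b, c, D, p; split=> //; split=> //.
  by apply: subset_closure; case: Tp; rewrite TE.
have [p Tp pN] := card_eq_notin (s := [:: a; b; c]) T4 isT; exists p.
by split=> // -[[]|] pE; rewrite pE !inE eqxx ?orbT in pN.
Qed.

End Classification.

(** * Stable sets *)

Section Stability.
Variable R : realType.
Variable S : set Z2.

Lemma full_quad (s t : seq pt) (p u v : Z2) : det2 u v = 1 ->
  ~ (quad s p u v `&` S #= `I_3) -> uniq s -> size s = 4%N ->
  uniq t -> size t = 3%N -> all [in s] t ->
  {in t, forall z, S (frame p u v z)} -> {in s, forall z, S (frame p u v z)}.
Proof.
move=> uv nS us s4 ut t3 ts tS z zs.
have s4' : quad s p u v #= `I_4 by rewrite -s4; exact: quad_card.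
have t3' : quad t p u v #= `I_3 by rewrite -t3; exact: quad_card.
have sub : quad t p u v `<=` quad s p u v.
  by move=> _ /mapP[w wt ->]; apply: map_f; exact: (allP ts).
apply: (full_of_three s4' nS sub t3'); last exact: map_f.
by move=> _ /mapP[w wt ->]; exact: tS.
Qed.

Lemma B_stable_full (t : seq pt) (p u v : Z2) : B_stable R S -> det2 u v = 1 ->
  uniq t -> size t = 3%N -> all [in border_star] t ->
  {in t, forall z, S (frame p u v z)} ->
  {in border_star, forall z, S (frame p u v z)}.
Proof.
move=> BS uv; apply: full_quad => // TS; apply: BS.
exists (quad border_star p u v).
by split=> //; apply/border_triangleP; exists p, u, v.
Qed.

Lemma I_stable_full (t : seq pt) (p u v : Z2) : I_stable R S -> det2 u v = 1 ->
  uniq t -> size t = 3%N -> all [in star] t ->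
  {in t, forall z, S (frame p u v z)} -> {in star, forall z, S (frame p u v z)}.
Proof.
move=> IS uv; apply: full_quad => // TS; apply: IS; exists (quad star p u v).
by split=> //; apply/internal_triangleP; exists p, u, v.
Qed.

(** The shear [v + k *: u] keeps the determinant, so each point of the adjacent row is the apex of a
    border triangle over the same three base points. *)
Lemma B_stable_row (p u v : Z2) : B_stable R S -> det2 u v = 1 ->
  S p -> S (p + u) -> S (p - u) -> forall k : int, S (p + v + k *: u).
Proof.
move=> BS uv S0 S1 S2 k.
have uv' : det2 u (v + k *: u) = 1 by rewrite -uv /det2 !mxE; ring.
have := B_stable_full (t := [:: (0, 0); (1, 0); (-1, 0)]) (p := p)
          BS uv' isT erefl.
have -> : p + v + k *: u = frame p u (v + k *: u) (0, 1).
  by rewrite /frame /= scale0r scale1r addr0 addrA.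
apply => // z; rewrite !inE => /or3P[] /eqP ->;
  by rewrite /frame /= ?scale0r ?scale1r ?scaleN1r !addr0.
Qed.

Lemma B_stable_line (p u v : Z2) : B_stable R S -> det2 u v = 1 ->
  S p -> S (p + u) -> S (p - u) -> S = [set: Z2].
Proof.
move=> BS uv S0 S1 S2.
pose row q := forall k : int, S (q + k *: u).
have next q w : `|det2 u w| = 1 -> row q -> row (q + w).
  move=> uw Sq k.
  have Sq0 : S q by have := Sq 0; rewrite scale0r addr0.
  have Sq1 : S (q + u) by have := Sq 1; rewrite scale1r.
  have Sq2 : S (q - u) by have := Sq (-1); rewrite scaleN1r.
  (* For determinant -1, [- u] replaces [u], which only exchanges the known points [q + u] and
     [q - u]. *)
  have [uw1|uw1] : det2 u w = 1 \/ det2 (- u) w = 1.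
    have -> : det2 (- u) w = - det2 u w by rewrite /det2 !mxE; ring.
    by lia.
    exact: B_stable_row.
  have := @B_stable_row q (- u) w BS uw1 Sq0 Sq2.
  rewrite opprK => /(_ Sq1 (- k)).
  by rewrite scaleNr scalerN opprK.
(* The induction starts one row away from [p], whose own row is so far known at three points only;
   hence the index [t - 1] below. *)
have rows (j : int) : row (p + v + j *: v).
  elim/int_rect: j => [|n IHn|n IHn].
  - by rewrite scale0r addr0; exact: B_stable_row.
  - by rewrite intS scalerDl scale1r (addrC v) addrA; apply: next; rewrite ?uv.
  - rewrite intS opprD scalerDl scaleN1r (addrC (- v)) addrA; apply: next => //.
    have -> : det2 u (- v) = - det2 u v by rewrite /det2 !mxE; ring.
    by rewrite uv normrN1.
apply/seteqP; split=> // x _.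
rewrite (frame_coord p x uv) /frame /=.
move: (det2 _ v) (det2 u _) => s t.
have := rows (t - 1) s; rewrite scalerBl scale1r.
by congr S; apply: cV2_eq; rewrite !mxE; ring.
Qed.

Lemma frame_comp (p u v : Z2) (z x y w : pt) :
  frame (frame p u v z) (x.1 *: u + x.2 *: v) (y.1 *: u + y.2 *: v) w =
  frame p u v (z + (w.1 * x.1 + w.2 * y.1, w.1 * x.2 + w.2 * y.2)).
Proof. by apply: cV2_eq; rewrite /frame !mxE /=; ring. Qed.

(** The four points form the star of a new frame spanned by the images of [x] and [y]; determinant
    -1 reduces to determinant 1 by exchanging the two vectors. *)
Lemma I_stable_closed (p u v : Z2) : I_stable R S -> det2 u v = 1 ->
  internal_closed [set z | S (frame p u v z)].
Proof.
move=> IS uv.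
suff pos (q x y : pt) (Q := [set z | S (frame p u v z)]) :
    x.1 * y.2 - x.2 * y.1 = 1 ->
    (Q q -> Q (q + x) -> Q (q + y) -> Q (q - x - y)) /\
    (Q (q + x) -> Q (q + y) -> Q (q - x - y) -> Q q).
  move=> q x y xy.
  have [d1|d1] : x.1 * y.2 - x.2 * y.1 = 1 \/ y.1 * x.2 - y.2 * x.1 = 1 by lia.
    exact: pos.
  have [c1 c2] := pos q y x d1; rewrite addrAC in c1 c2.
  by split=> [h1 h2 h3|h1 h2 h3]; [exact: c1|exact: c2].
move=> xy.
have XY : det2 (x.1 *: u + x.2 *: v) (y.1 *: u + y.2 *: v) = 1.
  transitivity (det2 u v * (x.1 * y.2 - x.2 * y.1)); last by rewrite uv xy.
  by rewrite /det2 !mxE; ring.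
pose F := frame (frame p u v q) (x.1 *: u + x.2 *: v) (y.1 *: u + y.2 *: v).
have FE w z : z = q + (w.1 * x.1 + w.2 * y.1, w.1 * x.2 + w.2 * y.2) ->
    Q z = S (F w).
  by move=> ->; rewrite /F frame_comp.
have e0 : Q q = S (F (0, 0)).
  by apply: FE; apply: injective_projections; rewrite /=; ring.
have e1 : Q (q + x) = S (F (1, 0)).
  by apply: FE; apply: injective_projections; rewrite /=; ring.
have e2 : Q (q + y) = S (F (0, 1)).
  by apply: FE; apply: injective_projections; rewrite /=; ring.
have e3 : Q (q - x - y) = S (F (-1, -1)).
  by apply: FE; apply: injective_projections; rewrite /=; ring.
rewrite e0 e1 e2 e3; split=> h1 h2 h3.
  apply: (I_stable_full (t := [:: (0, 0); (1, 0); (0, 1)]) IS XY) => //.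
  by move=> z; rewrite !inE => /or3P[] /eqP ->.
apply: (I_stable_full (t := [:: (1, 0); (0, 1); (-1, -1)]) IS XY) => //.
by move=> z; rewrite !inE => /or3P[] /eqP ->.
Qed.

End Stability.

(** * The standard sets in coordinates, their rotation, and unimodular maps *)

Definition coords (x : Z2) : pt := (x 0 0, x 1 0).

Lemma coordsD4 x q : coords (x + q *+ 4) = coords q *+ 4 + coords x.
Proof.
by rewrite pair_mulr4 addrC -scaler_nat /coords !mxE /= ![4%:R * _]mulrC.
Qed.

Lemma Delta0_coords x : Delta0 x <-> coords x \in star.
Proof.
rewrite /Delta0 !inE; split.
  by case=> [[[->|->]|->]|->]; rewrite /coords !mxE.
by case/or4P=> /eqP[x0 x1];
  [left; left; left|left; left; right|left; right|right];
  apply: cV2_eq; rewrite !mxE.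
Qed.

Lemma J_quarter_coords x : J_quarter x <-> star4 (coords x).
Proof.
split=> [[y /Delta0_coords ys [q _ <-]]|/star4P[q [r [rs xE]]]].
  by rewrite coordsD4 star4_addM4; move: (coords y) ys; apply/allP.
exists (vec2 r.1 r.2).
  by apply/Delta0_coords; rewrite /coords !mxE /= -surjective_pairing.
exists (vec2 q.1 q.2) => //; move: xE; rewrite pair_mulr4 => -[x0 x1].
by apply: cV2_eq; rewrite -scaler_nat !mxE /= ?x0 ?x1; ring.
Qed.

(** Since [2] and [-2] agree modulo 4, the added class is that of the shift [2 e3]. *)
Lemma J_half_coords x :
  J_half x <-> star4 (coords x) || star4 (coords x - (-2, -2)).
Proof.
have shift y : coords (y + vec2 2 2) = coords y + (2, 2).
  by rewrite /coords !mxE.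
rewrite /J_half; split.
  case=> [/J_quarter_coords ->//|[y /J_quarter_coords ys <-]].
  by rewrite shift -addrA [_ - _](_ : _ = 1 *+ 4) // addrC star4_addM4 ys orbT.
case/orP=> xs; first by left; apply/J_quarter_coords.
right; exists (x - vec2 2 2); last by rewrite subrK.
apply/J_quarter_coords; rewrite -(star4_addM4 1); move: xs; congr star4.
by rewrite /coords !mxE; congr pair; rewrite /=; ring.
Qed.

(* The linear map [e1 -> e2 -> e3 -> e1]. *)
Definition rot3 (z : pt) : pt := (- z.2, z.1 - z.2).

Lemma star4_rot3 z : star4 (rot3 z) = star4 z.
Proof.
have [q [r [-> rs]]] := div4P z.
have -> : rot3 (q *+ 4 + r) = rot3 q *+ 4 + rot3 r.
  by rewrite !pair_mulr4 /rot3 /=; congr pair; rewrite /=; ring.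
by rewrite !star4_addM4; apply/eqP; move: r rs; apply/allP; vm_compute.
Qed.

Lemma frame_rot3 p u v z : frame p v (- u - v) z = frame p u v (rot3 z).
Proof. by apply: cV2_eq; rewrite /frame !mxE /=; ring. Qed.

Lemma det2_rot3 (u v : Z2) : det2 v (- u - v) = det2 u v.
Proof. by rewrite /det2 !mxE; ring. Qed.

Lemma unimodular_frame p u v : det2 u v = 1 ->
  unimodular (fun x => frame p u v (coords x)).
Proof.
move=> uv; have l1 : lift 0 0 = 1 :> 'I_2 by apply/val_inj.
exists (\matrix_(i, j) if j == 0 then u i 0 else v i 0), p; split.
  left; rewrite (expand_det_row _ 0) !big_ord_recl big_ord0 /cofactor !det_mx11.
  by rewrite !mxE /= l1 /bump addn0 add0n expr0 expr1 -[RHS]uv /det2; ring.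
move=> x; rewrite /frame /coords; apply: cV2_eq;
  by rewrite !mxE !big_ord_recl big_ord0 !mxE /= l1; ring.
Qed.

Lemma image_frame (S A : set Z2) p u v : det2 u v = 1 ->
  (forall x, S (frame p u v (coords x)) <-> A x) ->
  S = (fun x => frame p u v (coords x)) @` A.
Proof.
move=> uv SA; apply/seteqP; split=> [x Sx|_ [x Ax <-]]; last exact/SA.
have xE := frame_coord p x uv; move: xE Sx; set z := (_, _) => -> Sx.
have zE : coords (vec2 z.1 z.2) = z by rewrite /coords !mxE.
by exists (vec2 z.1 z.2); rewrite ?zE //; apply/SA; rewrite zE.
Qed.

Lemma contains_three_full (S T : set Z2) : T #= `I_4 -> ~ (T `&` S #= `I_3) ->
  contains_three_points S T -> T `<=` S.
Proof. by move=> T4 nS [U [UT U3 US]]; exact: full_of_three UT U3 US. Qed.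

Theorem theorem1p3 (R : realType) (S : set Z2) :
  (B_stable R S ->
   (exists T, border_triangle R T /\ contains_three_points S T) ->
   S = [set: Z2]) /\
  (BI_stable R S ->
   (exists T, minimal_triangle R T /\ contains_three_points S T) ->
   S = [set: Z2]) /\
  (I_stable R S ->
   (exists T, internal_triangle R T /\ contains_three_points S T) ->
   exists f : Z2 -> Z2, unimodular f /\
     (S = f @` J_quarter \/ S = f @` J_half \/ S = f @` [set: Z2])).
Proof.
have partB T : B_stable R S -> border_triangle R T ->
    contains_three_points S T ->
    S = [set: Z2].
  move=> BS bT T3.
  have TS : T `<=` S.
    apply: contains_three_full T3 => [|TS];
      by [case: bT => -[]|apply: BS; exists T].
  have [p [u [v [uv TE]]]] := (border_triangleP R T).1 bT; rewrite {}TE in TS.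
  have Sz z : z \in border_star -> S (frame p u v z).
    by move=> zs; apply/TS/map_f.
  apply: (B_stable_line (p := p) BS uv).
  - by have := Sz (0, 0) isT; rewrite /frame /= !scale0r !addr0.
  - by have := Sz (1, 0) isT; rewrite /frame /= scale0r scale1r !addr0.
  - by have := Sz (-1, 0) isT; rewrite /frame /= scale0r scaleN1r !addr0.
have partI T : I_stable R S -> internal_triangle R T ->
    contains_three_points S T ->
    exists p u v, det2 u v = 1 /\ {in star, forall z, S (frame p u v z)}.
  move=> IS iT T3.
  have TS : T `<=` S.
    apply: contains_three_full T3 => [|TS];
      by [case: iT => -[]|apply: IS; exists T].
  have [p [u [v [uv TE]]]] := (internal_triangleP R T).1 iT; rewrite {}TE in TS.
  by exists p, u, v; split=> // z zs; apply/TS/map_f.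
split; first by move=> BS [T [bT T3]]; exact: partB T3.
split.
  move=> [BS IS] [T [/minimal_triangle_border_or_internal[bT|iT] T3]].
    exact: partB T3.
  have [p [u [v [uv Sz]]]] := partI T IS iT T3.
  (* The two standard triangles share three points, so B-stability supplies [(-1, 0)] and with it
     three points in a row. *)
  have Sb : {in border_star, forall z, S (frame p u v z)}.
    apply: (B_stable_full (t := [:: (0, 0); (1, 0); (0, 1)]) BS uv) => //.
    by move=> z; rewrite !inE => /or3P[] /eqP ->; apply: Sz.
  apply: (B_stable_line (p := p) BS uv).
  - by have := Sz (0, 0) isT; rewrite /frame /= !scale0r !addr0.
  - by have := Sz (1, 0) isT; rewrite /frame /= scale0r scale1r !addr0.
  - by have := Sb (-1, 0) isT; rewrite /frame /= scale0r scaleN1r !addr0.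
move=> IS [T [iT T3]]; have [p [u [v [uv Sz]]]] := partI T IS iT T3.
have half u' v' : det2 u' v' = 1 ->
    (forall z, S (frame p u' v' z) <-> star4 z || star4 (z - (-2, -2))) ->
    exists f : Z2 -> Z2, unimodular f /\
     (S = f @` J_quarter \/ S = f @` J_half \/ S = f @` [set: Z2]).
  move=> uv' Sf; exists (fun x => frame p u' v' (coords x)).
  split; first exact: unimodular_frame.
  by right; left; apply: image_frame => // x; rewrite Sf J_half_coords.
have rotB z s : rot3 z - rot3 s = rot3 (z - s).
  by rewrite /rot3 /=; congr pair; rewrite /=; ring.
case: (internal_closed_cases (I_stable_closed p IS uv) Sz)
  => [Sq|[s ss Sh]|Sall].
- exists (fun x => frame p u v (coords x)).
  split; first exact: unimodular_frame.
  left; apply: image_frame => // x.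
  by apply: iff_trans (Sq (coords x)) (iff_sym (J_quarter_coords x)).
- move: ss; rewrite !inE => /or3P[] /eqP sE; rewrite {}sE in Sh.
  (* In the rotated frame the occupied class of [2 e1] becomes that of [2 e3]; for [2 e2] the
     rotation is applied twice. *)
  + apply: (half v (- u - v)) => [|z]; first by rewrite det2_rot3.
    rewrite frame_rot3; apply: iff_trans (Sh _) _.
    by rewrite -[(2, 0)]/(rot3 (-2, -2)) rotB !star4_rot3.
  + apply: (half (- u - v) (- v - (- u - v))) => [|z].
      by rewrite !det2_rot3.
    rewrite !frame_rot3; apply: iff_trans (Sh _) _.
    by rewrite -[(0, 2)]/(rot3 (rot3 (-2, -2))) !rotB !star4_rot3.
  + exact: (half u v).
- exists (fun x => frame p u v (coords x)).
  split; first exact: unimodular_frame.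
  by right; right; apply: image_frame => // x; split=> // _; exact: Sall.
Qed.
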